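(* Let $L$ be a stable intermediate logic other than $\mathbf{IPC}$ such that some poset of height at least $2$ validates $L$. Then $L$ is not polyhedrally complete.
   Context: Formulas are those of intuitionistic propositional logic; posets serve as Kripke frames with the standard intuitionistic semantics. An intermediate logic is a consistent set of formulas containing $\mathbf{IPC}$ and closed under modus ponens and substitution. The height of a poset $F$ is $\sup\{|X|-1 : X\subseteq F \text{ a chain}\}$. An intermediate logic $L$ is stable if the class of rooted posets validating $L$ is closed under monotone images: whenever $F$ is a rooted poset validating $L$ and $g\colon F\to G$ is a surjective order-preserving map onto a poset $G$, then $G$ validates $L$. A polyhedron in $\mathbb{R}^n$ is a finite union of convex hulls of finite sets; an open subpolyhedron of $P$ is the complement in $P$ of a subpolyhedron; the set $\mathrm{Sub}_{\mathrm{o}}P$ of open subpolyhedra is a Heyting algebra, and $P$ validates a formula iff $\mathrm{Sub}_{\mathrm{o}}P$ does. A logic is polyhedrally complete if it is the set of formulas valid in all members of some class of polyhedra. *)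

(* Defs.v *)
From HB Require Import structures.
From mathcomp Require Import all_boot all_order all_algebra.
From mathcomp Require Import all_classical all_reals all_analysis.

Set Implicit Arguments.
Unset Strict Implicit.
Unset Printing Implicit Defensive.

Import Order.TTheory GRing.Theory Num.Theory.

Local Open Scope classical_set_scope.

(* Negation is [Imp A Bot]. *)
Inductive formula : Type :=
| Var of nat
| Bot
| And of formula & formula
| Or of formula & formula
| Imp of formula & formula.

Fixpoint subst (s : nat -> formula) (A : formula) : formula :=
  match A with
  | Var i => s i
  | Bot => Bot
  | And A B => And (subst s A) (subst s B)
  | Or A B => Or (subst s A) (subst s B)
  | Imp A B => Imp (subst s A) (subst s B)
  end.

(* Hilbert-style axiomatization of intuitionistic propositional logic. *)
Inductive IPC : set formula :=
| IPC_K A B : IPC (Imp A (Imp B A))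
| IPC_S A B C : IPC (Imp (Imp A (Imp B C)) (Imp (Imp A B) (Imp A C)))
| IPC_andI A B : IPC (Imp A (Imp B (And A B)))
| IPC_andEl A B : IPC (Imp (And A B) A)
| IPC_andEr A B : IPC (Imp (And A B) B)
| IPC_orIl A B : IPC (Imp A (Or A B))
| IPC_orIr A B : IPC (Imp B (Or A B))
| IPC_orE A B C : IPC (Imp (Imp A C) (Imp (Imp B C) (Imp (Or A B) C)))
| IPC_botE A : IPC (Imp Bot A)
| IPC_mp A B : IPC (Imp A B) -> IPC A -> IPC B.

Record intermediate_logic (L : set formula) : Prop := IntermediateLogic {
  logic_consistent : ~ L Bot;
  logic_IPC : IPC `<=` L;
  logic_mp : forall A B, L (Imp A B) -> L A -> L B;
  logic_subst : forall s A, L A -> L (subst s A) }.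

Section Kripke.
Context (d : Order.disp_t) (F : porderType d).
Local Open Scope order_scope.

Definition up_closed (U : set F) : Prop := forall x y, x <= y -> U x -> U y.

Fixpoint forces (v : nat -> set F) (x : F) (A : formula) : Prop :=
  match A with
  | Var i => v i x
  | Bot => False
  | And A B => forces v x A /\ forces v x B
  | Or A B => forces v x A \/ forces v x B
  | Imp A B => forall y, x <= y -> forces v y A -> forces v y B
  end.

Definition frame_valid (A : formula) : Prop :=
  forall v : nat -> set F, (forall i, up_closed (v i)) ->
  forall x, forces v x A.

Definition frame_validates (L : set formula) : Prop := L `<=` frame_valid.

Definition rooted : Prop := exists r : F, forall x, r <= x.

(* [counting] is the cardinality, with value [+oo] on infinite sets. *)
Definition height (R : realType) : \bar R :=
  ereal_sup [set (counting X - 1)%E | X in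
              [set X : set F | total_on X (fun x y => x <= y)]].

End Kripke.
Arguments height {d} F R.

Definition stable (L : set formula) : Prop :=
  forall (d d' : Order.disp_t) (F : porderType d) (G : porderType d')
         (g : F -> G),
    rooted F -> frame_validates F L ->
    {homo g : x y / (x <= y)%O} -> set_surj setT setT g ->
    frame_validates G L.

(* Algebraic semantics in a family [O] of sets that, ordered by inclusion, is a
   Heyting algebra whose bounded lattice operations are set0, `&` and `|`. The
   Heyting implication of [U] and [V] is then the greatest [W] in [O] with
   [W `&` U `<=` V]; being the greatest, it is the union of all such [W]. *)
Section SetHeyting.
Context (T : Type) (O : set (set T)).

Definition himp (U V : set T) : set T :=
  \bigcup_(W in [set W | O W /\ W `&` U `<=` V]) W.

Fixpoint heval (v : nat -> set T) (A : formula) : set T :=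
  match A with
  | Var i => v i
  | Bot => set0
  | And A B => heval v A `&` heval v B
  | Or A B => heval v A `|` heval v B
  | Imp A B => himp (heval v A) (heval v B)
  end.

Definition heyting_valid (top : set T) (A : formula) : Prop :=
  forall v : nat -> set T, (forall i, O (v i)) -> heval v A = top.

End SetHeyting.

Section Polyhedra.
Context (R : realType) (n : nat).

Definition convex_hull (A : set 'rV[R]_n) : set 'rV[R]_n :=
  smallest (@convex_set R 'rV[R]_n) A.

Definition polyhedron (P : set 'rV[R]_n) : Prop :=
  exists (k : nat) (V : 'I_k -> set 'rV[R]_n),
    (forall i, finite_set (V i)) /\ P = \bigcup_i convex_hull (V i).

Definition open_subpolyhedra (P : set 'rV[R]_n) : set (set 'rV[R]_n) :=
  [set P `\` Q | Q in [set Q | polyhedron Q /\ Q `<=` P]].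

Definition polyhedron_valid (P : set 'rV[R]_n) (A : formula) : Prop :=
  heyting_valid (open_subpolyhedra P) P A.

End Polyhedra.

(* A class of polyhedra may contain polyhedra of various ambient dimensions. *)
Definition polyhedrally_complete (R : realType) (L : set formula) : Prop :=
  exists C : forall n : nat, set (set 'rV[R]_n),
    (forall n P, C n P -> polyhedron P) /\
    L = [set A | forall n P, C n P -> polyhedron_valid P A].

(* Main.v *)
Require Import Defs.
From HB Require Import structures.
From mathcomp Require Import all_boot all_order all_algebra finmap.
From mathcomp Require Import all_classical all_reals all_analysis.
From mathcomp Require Import ring lra.

(* If [L] is the logic of a class [C] of polyhedra and some frame of height 2
   validates [L], then [L] does not contain the formula [bd2] of depth 2, so
   some [P] in [C] refutes [bd2]. A union of segments and points validates
   [bd2], hence [P] has dimension at least 2. Near a generic point [P] is an open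
   piece of an affine space of maximal dimension; cutting this piece by [m]
   hyperplanes through a common subspace of codimension 2 maps it onto the face
   poset of [m] lines of the plane, a fan, in such a way that validity in [P] is
   inherited by the fan. A fan has arbitrarily many maximal elements, so every
   finite rooted poset is a monotone image of a fan: send the maximal faces
   anywhere and all other faces to the root. By stability all finite rooted posets
   validate [L], and by the finite model property [L] is IPC. *)

Set Implicit Arguments.
Unset Strict Implicit.
Unset Printing Implicit Defensive.

Import Order.TTheory GRing.Theory Num.Theory numFieldNormedType.Exports.
Local Open Scope classical_set_scope.

(** * Finite model property of IPC *)

(** Theorems of [IPC] enter as axioms and modus ponens is the only rule, so the deduction theorem
    follows from the schemes K and S alone. *)
Inductive derives (X : set formula) : formula -> Prop :=
| derives_hyp A : X A -> derives X A
| derives_ax A : IPC A -> derives X A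
| derives_mp A B : derives X (Imp A B) -> derives X A -> derives X B.

Lemma derives0 A : derives set0 A -> IPC A.
Proof. by elim=> {A} [A []|//|A B _ iAB _]; exact: IPC_mp. Qed.

Lemma derives_sub (X Y : set formula) A :
  (forall B, X B -> derives Y B) -> derives X A -> derives Y A.
Proof.
move=> XY; elim=> {A} [A /XY//|A|A B _ iAB _]; first exact: derives_ax.
exact: derives_mp.
Qed.

Lemma derives_le (X Y : set formula) A : X `<=` Y -> derives X A -> derives Y A.
Proof. by move=> XY; apply: derives_sub => B /XY; exact: derives_hyp. Qed.

Lemma IPC_refl A : IPC (Imp A A).
Proof.
by apply: IPC_mp (IPC_K A A); apply: IPC_mp (IPC_K A (Imp A A)); exact: IPC_S.
Qed.

Lemma deduction (X : set formula) A B :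
  derives (A |` X) B <-> derives X (Imp A B).
Proof.
split=> [|AB]; last first.
  apply: (@derives_mp _ A); last by apply: derives_hyp; left.
  by apply: derives_le AB => C; right.
have K C : derives X C -> derives X (Imp A C).
  by apply: derives_mp; exact/derives_ax/IPC_K.
elim=> {B} [B [->|XB]|B iB|B C _ iBC _].
- exact/derives_ax/IPC_refl.
- exact/K/derives_hyp.
- exact/K/derives_ax.
- by apply: derives_mp; apply: derives_mp iBC; exact/derives_ax/IPC_S.
Qed.

Fixpoint subformulas (A : formula) : seq formula :=
  A :: match A with
       | And B C | Or B C | Imp B C => subformulas B ++ subformulas C
       | _ => [::]
       end.

HB.instance Definition _ := gen_eqMixin formula.

Section FiniteCanonicalModel.
Variable A0 : formula.
Let S := subformulas A0.
Let k := size S.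
Let form (i : 'I_k) : formula := nth Bot S i.

(** A theory is encoded by a set of positions in the list of subformulas of [A0]. This makes the
    canonical model finite by construction; two sets of positions may encode the same theory when a
    subformula is repeated. *)
Definition canonical_theory (X : {set 'I_k}) : set formula :=
  [set A | exists2 i, i \in X & form i = A].
Local Notation theory := canonical_theory.

(** Consistent prime theories, deductively closed relative to the subformulas of [A0]. *)
Definition canonical_world (X : {set 'I_k}) : Prop :=
  [/\ forall A, A \in S -> derives (theory X) A -> theory X A,
      forall A B, theory X (Or A B) -> theory X A \/ theory X B
    & ~ theory X Bot].

Let sub_S A B : B \in subformulas A -> {subset subformulas B <= subformulas A}.
Proof.
by elim: A => [i|| A IA C IC | A IA C IC | A IA C IC] /=;
  rewrite in_cons => /orP[/eqP->//|]; rewrite ?mem_cat //;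
  case/orP=> [/IA|/IC] h x /h xs; rewrite in_cons mem_cat xs ?orbT.
Qed.

Let mem_self A : A \in subformulas A. Proof. by case: A => *; exact: mem_head. Qed.

Let theory_S X A : theory X A -> A \in S.
Proof. by move=> [i _ <-]; exact: mem_nth. Qed.

Let theoryU (X : {set 'I_k}) A : A \in S ->
  exists2 Y : {set 'I_k}, X \subset Y & theory Y = A |` theory X.
Proof.
move=> AS; have jk : (index A S < k)%N by rewrite index_mem.
exists (Ordinal jk |: X)%SET; first exact: finset.subsetUr.
have jA : form (Ordinal jk) = A by rewrite /form /= nth_index.
apply/seteqP; split=> [B [i]|B [->|[i iX iB]]].
- by rewrite !inE => /orP[/eqP->|iX] <-; [left|right; exists i].
- by exists (Ordinal jk) => //; rewrite finset.setU11.
- by exists i => //; rewrite finset.setU1r.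
Qed.

Lemma theoryS (X Y : {set 'I_k}) : X \subset Y -> theory X `<=` theory Y.
Proof. by move=> /fintype.subsetP XY B [i iX iB]; exists i => //; exact: XY. Qed.

(** Among the finitely many supersets of [X] not deriving [D], take a maximal one. Adding any absent
    subformula then makes [D] derivable, whence closure and primeness. *)
Lemma lindenbaum (X : {set 'I_k}) D : ~ derives (theory X) D ->
  exists Y : {set 'I_k}, [/\ canonical_world Y, X \subset Y & ~ theory Y D].
Proof.
move=> /asboolPn XD.
have [Y /maxsetP[/asboolPn YD Ymax] XY] :=
  @maxset_exists _ (fun Z => ~~ `[< derives (theory Z) D >]) X XD.
have Yin A : A \in S -> ~ theory Y A -> derives (A |` theory Y) D.
  move=> AS YA; have [Z YZ eZ] := theoryU Y AS.
  apply: contrapT; rewrite -eZ => /asboolPn /Ymax /(_ YZ) ZY.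
  by apply: YA; rewrite -ZY eZ; left.
exists Y; split=> // [|YDt]; last exact/YD/derives_hyp.
split=> [A AS YA|A B YAB|YB].
- apply: contrapT => nYA; apply: YD.
  by apply: derives_mp YA; apply/deduction; exact: Yin.
- have ABS := theory_S YAB; have sAB := sub_S ABS.
  apply: contrapT => /not_orP[nA nB]; apply: YD.
  have /deduction dA : derives (A |` theory Y) D.
    by apply: Yin nA; apply: sAB; rewrite /= in_cons mem_cat mem_self orbT.
  have /deduction dB : derives (B |` theory Y) D.
    by apply: Yin nB; apply: sAB; rewrite /= in_cons mem_cat mem_self !orbT.
  apply: derives_mp (derives_hyp YAB); apply: derives_mp dB.
  by apply: derives_mp dA; exact/derives_ax/IPC_orE.
- apply: YD; apply: derives_mp (derives_hyp YB); exact/derives_ax/IPC_botE.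
Qed.

Variable X0 : {set 'I_k}.

(** Only worlds above [X0] are kept, so that [X0] is the root as soon as it is a world. *)
Definition canonical_frame : Type :=
  {X : {set 'I_k} | `[< canonical_world X /\ X0 \subset X >]}.
HB.instance Definition _ := SubFinite.on canonical_frame.

Let le (X Y : canonical_frame) := val X \subset val Y.
Let le_refl : reflexive le. Proof. by move=> X; exact: fintype.subxx. Qed.
Let le_anti : antisymmetric le.
Proof.
by move=> X Y XY; apply/val_inj/eqP; rewrite finset.eqEsubset.
Qed.
Let le_trans : transitive le.
Proof. by move=> Y X Z; exact: fintype.subset_trans. Qed.

HB.instance Definition _ :=
  Order.Le_isPOrder.Build Order.default_display canonical_frame le_refl le_anti le_trans.

Lemma canonical_truth (X : canonical_frame) A : A \in S ->
  forces (fun i => [set Y : canonical_frame | theory (val Y) (Var i)]) X A <->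
  theory (val X) A.
Proof.
have world (Y : canonical_frame) : canonical_world (val Y) /\ X0 \subset val Y.
  exact/asboolP/(valP Y).
elim: A X => [i||B IB C IC|B IB C IC|B IB C IC] X AS //=.
- by split=> // X0'; have [[_ _]] := world X.
all: have BS : B \in S by apply: (sub_S AS); rewrite /= in_cons mem_cat mem_self orbT.
all: have CS : C \in S by apply: (sub_S AS); rewrite /= in_cons mem_cat mem_self !orbT.
all: have [[Xcl Xor Xbot] X0X] := world X.
- rewrite IB// IC//; split=> [[XB XC]|XBC].
  + apply: Xcl => //; apply: derives_mp (derives_hyp XC).
    by apply: derives_mp (derives_hyp XB); exact/derives_ax/IPC_andI.
  + split; apply: Xcl => //; apply: derives_mp (derives_hyp XBC);
      apply: derives_ax; [exact: IPC_andEl|exact: IPC_andEr].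
- rewrite IB// IC//; split=> [[XB|XC]|/Xor//].
  + apply: Xcl => //; apply: derives_mp (derives_hyp XB).
    exact/derives_ax/IPC_orIl.
  + apply: Xcl => //; apply: derives_mp (derives_hyp XC).
    exact/derives_ax/IPC_orIr.
- split=> [XBC|XBC Y XY]; last first.
    rewrite IB// IC// => YB; have [[Ycl _ _] _] := world Y.
    apply: Ycl => //; apply: derives_mp (derives_hyp YB).
    exact/derives_hyp/(theoryS XY).
  (* If [C] were not derivable after adding [B], [lindenbaum] would yield a world above [X] that
     contains [B] and omits [C]. *)
  apply: Xcl => //; apply/deduction.
  have [Z XZ eZ] := theoryU (val X) BS; rewrite -eZ.
  apply: contrapT => /lindenbaum[Y [wY ZY YC]].
  have X0Y : X0 \subset Y.
    exact: fintype.subset_trans (fintype.subset_trans X0X XZ) ZY.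
  have PY : `[< canonical_world Y /\ X0 \subset Y >] by exact/asboolP.
  pose Y' : canonical_frame := exist _ Y PY.
  have XY' : (X <= Y')%O by exact: fintype.subset_trans ZY.
  apply: YC; have := XBC Y' XY'; rewrite IB// IC//; apply.
  by apply: (theoryS ZY); rewrite eZ; left.
Qed.

End FiniteCanonicalModel.

Lemma IPC_finite_rooted A :
  (forall (d : Order.disp_t) (G : finPOrderType d), rooted G -> frame_valid G A) ->
  IPC A.
Proof.
move=> GA; apply: contrapT => nA.
have nd : ~ derives (@canonical_theory A finset.set0) A.
  by move=> d0; apply/nA/derives0; apply: derives_le d0 => B [i]; rewrite inE.
(* The root is a world omitting [A], grown from the empty theory. *)
have [X [wX _ XA]] := lindenbaum nd.
have PX : `[< canonical_world X /\ X \subset X >] by exact/asboolP.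
pose X' : @canonical_frame A X := exist _ X PX.
have rX : rooted (@canonical_frame A X).
  by exists X' => Y; have /asboolP[] := valP Y.
have := GA _ (@canonical_frame A X) rX.
move=> /(_ (fun i => [set Y | canonical_theory (val Y) (Var i)])).
have up i : up_closed [set Y : @canonical_frame A X | canonical_theory (val Y) (Var i)].
  by move=> Y Z YZ; exact: (@theoryS _ (val Y) (val Z) YZ).
move=> /(_ up X') /canonical_truth XA'; apply: XA; apply: XA'.
by case: (A) => *; exact: mem_head.
Qed.

(** * Fans *)

Section Fan.
Local Open Scope ring_scope.
Variable R : realType.

Definition sign (x : R) : option bool := if x == 0 then None else Some (0 < x).

Lemma sign_eq_None x : (sign x == None) = (x == 0).
Proof. by rewrite /sign; case: ifP. Qed.

Section FanFrame.
Variable m : nat.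

Definition fan_signs (a b : R) : {ffun 'I_m -> option bool} :=
  [ffun i : 'I_m => sign (b - i%:R * a)].

(* The face poset of the arrangement of the [m] lines [b = i * a] of the plane:
   a face is encoded by the signs of the [m] linear forms on it. *)
Definition fan : Type := {s | `[< exists a b, s = fan_signs a b >]}.
HB.instance Definition _ := SubFinite.on fan.

Definition fan_face (a b : R) : fan :=
  exist _ (fan_signs a b) (asboolT (ex_intro _ a (ex_intro _ b erefl))).

Lemma fan_faceP (s : fan) : exists a b, s = fan_face a b.
Proof.
have /asboolP[a [b sE]] := valP s.
by exists a, b; apply: val_inj.
Qed.

(** The closure order of faces: [s] lies in the closure of [t]. *)
Definition fan_le (s t : fan) :=
  [forall i, (val s i == None) || (val s i == val t i)].

Lemma fan_leP (s t : fan) :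
  reflect (forall i, val s i = None \/ val s i = val t i) (fan_le s t).
Proof.
apply: (iffP forallP) => st i; have := st i; first by case/orP=> /eqP; [left|right].
by case=> ->; rewrite eqxx ?orbT.
Qed.

Fact fan_le_refl : reflexive fan_le.
Proof. by move=> s; apply/fan_leP => i; right. Qed.

Fact fan_le_anti : antisymmetric fan_le.
Proof.
move=> s t /andP[/fan_leP st /fan_leP ts]; apply/val_inj/ffunP => i.
by have [s0|//] := st i; have [t0|//] := ts i; rewrite s0 t0.
Qed.

Fact fan_le_trans : transitive fan_le.
Proof.
move=> t s u /fan_leP st /fan_leP tu; apply/fan_leP => i.
by have [|->] := st i; [left|exact: tu].
Qed.

HB.instance Definition _ :=
  Order.Le_isPOrder.Build Order.default_display fan fan_le_refl fan_le_anti fan_le_trans.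

Lemma fan_rooted : rooted fan.
Proof.
exists (fan_face 0 0) => s; apply/fan_leP => i; left.
by rewrite ffunE mulr0 subr0 /sign eqxx.
Qed.

End FanFrame.

Lemma fan_surjection (d : Order.disp_t) (G : finPOrderType d) : rooted G ->
  exists g : fan #|G| -> G,
    {homo g : x y / (x <= y)%O} /\ set_surj setT setT g.
Proof.
move=> [r rP]; set m := #|G|.
(* A face without zero sign is maximal and is numbered by its count of positive signs less one; the
   count 0 also gives the number 0. *)
pose g (s : fan m) : G :=
  if [exists i, val s i == None] then r
  else nth r (enum G) #|[set i | val s i == Some true]%SET|.-1.
exists g; split=> [s t /fan_leP st|y _].
  case: (boolP [exists i, val s i == None]) => [s0|/existsPn s0].
    by rewrite /g s0; exact: rP.
  suff -> : s = t by exact: lexx.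
  apply: val_inj; apply/ffunP => i; have [si|//] := st i.
  by have := s0 i; rewrite si eqxx.
(* The point [(1, j + 1/2)] is above the lines of slope 0, ..., [j] and below the others, so exactly
   [j + 1] signs are positive. *)
pose j := enum_rank y; exists (fan_face m 1 (j%:R + 2^-1)) => //.
have sE i : val (fan_face m 1 (j%:R + 2^-1)) i = Some (i <= j)%N.
  rewrite ffunE mulr1 /sign.
  have [ij|ji] := leqP i j.
    have : i%:R <= j%:R :> R by rewrite ler_nat.
    by move=> ?; rewrite gt_eqF; [congr Some|]; lra.
  have : j.+1%:R <= i%:R :> R by rewrite ler_nat.
  rewrite -natr1 => ?; rewrite lt_eqF; last lra.
  by congr Some; apply/negbTE; rewrite -leNgt; lra.
rewrite /g ifN; last by apply/existsPn => i; rewrite sE.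
have -> : #|[set i | val (fan_face m 1 (j%:R + 2^-1)) i == Some true]%SET| = j.+1.
  have jm : (j < m)%N by [].
  rewrite -sum1_card; under eq_bigl => i do rewrite inE sE (inj_eq (@Some_inj _)) eqb_id -ltnS.
  by rewrite -(big_ord_widen _ (fun=> 1%N) jm) sum1_card card_ord.
by rewrite /= -[RHS](enum_rankK y) (enum_val_nth r).
Qed.

End Fan.

(** * Polytopes and polyhedra *)

Section ConvexHull.
Local Open Scope ring_scope.
Variables (R : realType) (n : nat).
Implicit Types (X C : set 'rV[R]_n) (x y : 'rV[R]_n).

Lemma convex_setE C : @convex_set R 'rV[R]_n C <->
  forall x y (t : R), 0 <= t <= 1 -> C x -> C y -> C (t *: x + (1 - t) *: y).
Proof.
split=> [cC x y t /andP[t0 t1] Cx Cy|cC x y t].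
  by have := cC x y (Itv01 t0 t1); rewrite !inE; apply.
by rewrite !inE; apply: cC; rewrite ge0 le1.
Qed.

(** Induction on the list of points: partial sums rescaled to total weight 1 stay in [C], the
    partial sums of weight 0 being kept apart. *)
Lemma convex_set_sum C (I : finType) (c : I -> R) (p : I -> 'rV[R]_n) :
  @convex_set R 'rV[R]_n C -> (forall i, 0 <= c i) -> \sum_i c i = 1 ->
  (forall i, C (p i)) -> C (\sum_i c i *: p i).
Proof.
move=> /convex_setE cC c0 c1 Cp.
suff H (r : seq I) : (\sum_(i <- r) c i = 0 /\ \sum_(i <- r) c i *: p i = 0) \/
    0 < \sum_(i <- r) c i /\ C ((\sum_(i <- r) c i)^-1 *: \sum_(i <- r) c i *: p i).
  have [[]|[]] := H (index_enum I); first by rewrite /= c1 => /eqP; rewrite oner_eq0.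
  by rewrite /= c1 invr1 scale1r.
elim: r => [|i r IH]; first by left; rewrite !big_nil.
rewrite !big_cons; set s := \sum_(i <- r) c i; set y := \sum_(i <- r) _ *: _.
have [ci0|ci] := eqVneq (c i) 0; first by rewrite ci0 scale0r !add0r.
have {}ci : 0 < c i by rewrite lt_neqAle eq_sym ci c0.
right; move: IH; rewrite -/s -/y => -[[-> ->]|[s0 Cs]].
  by rewrite !addr0 ci scalerA mulVf ?gt_eqF// scale1r.
have cs : 0 < c i + s by exact: addr_gt0.
split=> //; have -> : (c i + s)^-1 *: (c i *: p i + y) =
    (c i / (c i + s)) *: p i + (1 - c i / (c i + s)) *: (s^-1 *: y).
  by rewrite scalerDr !scalerA; congr (_ *: _ + _ *: _); field; rewrite ?gt_eqF.
apply: cC => //; apply/andP; split; first by rewrite divr_ge0 ?ltW.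
by rewrite ler_pdivrMr// mul1r lerDl ltW.
Qed.

Definition combinations X : set 'rV[R]_n :=
  [set x | exists (I : finType) (c : I -> R) (p : I -> 'rV[R]_n),
    [/\ forall i, 0 <= c i, \sum_i c i = 1, forall i, X (p i)
      & x = \sum_i c i *: p i]].

Lemma sub_hull X : X `<=` convex_hull X.
Proof. by move=> x Xx C [_]; exact. Qed.

Lemma convex_convex_hull X : @convex_set R 'rV[R]_n (convex_hull X).
Proof.
apply/convex_setE => x y t t01 hx hy C CX.
by have [/convex_setE cC _] := CX; apply: cC => //; [exact: hx|exact: hy].
Qed.

Lemma convex_hull_min X C :
  @convex_set R 'rV[R]_n C -> X `<=` C -> convex_hull X `<=` C.
Proof. by move=> cC XC x; apply. Qed.

Lemma convex_hullS X Y : X `<=` Y -> convex_hull X `<=` @convex_hull R n Y.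
Proof.
move=> XY; apply: convex_hull_min (@convex_convex_hull Y) _.
exact: subset_trans XY (@sub_hull Y).
Qed.

Lemma convex_hullE X : convex_hull X = combinations X.
Proof.
apply/seteqP; split=> [|x [I [c [p [c0 c1 Xp ->]]]]]; last first.
  apply: convex_set_sum => //; first exact: convex_convex_hull.
  by move=> i; exact: sub_hull.
apply: convex_hull_min => [|x Xx]; last first.
  by exists unit, (fun=> 1), (fun=> x); rewrite !big_const card_unit /= addr0 scale1r addr0.
apply/convex_setE => ? ? t /andP[t0 t1].
move=> [I [c [p [c0 c1 Xp ->]]]] [J [d [q [d0 d1 Xq ->]]]].
exists (I + J)%type, (fun k => match k with inl i => t * c i | inr j => (1 - t) * d j end),
  (fun k => match k with inl i => p i | inr j => q j end).
rewrite !big_sumType /= -!mulr_sumr c1 d1 !mulr1; split=> //.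
- by case=> k; rewrite mulr_ge0// subr_ge0.
- by rewrite addrC subrK.
- by case.
- by rewrite !scaler_sumr; congr (_ + _); apply: eq_bigr => k _; rewrite scalerA.
Qed.

Lemma convex_hull0 : convex_hull set0 = set0 :> set 'rV[R]_n.
Proof.
rewrite convex_hullE; apply/seteqP; split=> // x [I [c [p [_ c1 p0 _]]]].
move: c1; rewrite big1 => [/esym/eqP|i _]; first by rewrite oner_eq0.
by have := p0 i.
Qed.

(** The hull is a cone with apex [v]. The apex is listed separately because the cone over an empty
    hull is empty. Adding points one by one in this way gives compactness. *)
Lemma convex_hullU1 v X : convex_hull (v |` X) =
  v |` (fun ty => ty.1 *: v + (1 - ty.1) *: ty.2) @`
       (`[0, 1]%classic `*` convex_hull X) :> set 'rV[R]_n.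
Proof.
apply/seteqP; split=> [|x [->|[[t y] /= [t01 Xy]] <-]]; last first.
- have /convex_setE := @convex_convex_hull (v |` X); apply=> //.
    by apply: sub_hull; left.
  by apply: convex_hullS Xy => z; right.
- by apply: sub_hull; left.
rewrite convex_hullE => x [I [c [p [c0 c1 vXp ->]]]].
pose V := [pred i | `[< p i = v >]].
rewrite (bigID V)/=; rewrite (bigID V)/= in c1.
set a := (X in X + _ = _) in c1; set b := (X in _ + X = _) in c1.
have a0 : 0 <= a by exact: sumr_ge0.
have b0 : 0 <= b by exact: sumr_ge0.
have -> : \sum_(i | `[< p i = v >]) c i *: p i = a *: v.
  by rewrite scaler_suml; apply: eq_bigr => i /asboolP ->.
have [b00|bn0] := eqVneq b 0.
  left; rewrite -[a]addr0 -b00 c1 scale1r big1 ?addr0// => i iV.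
  by rewrite (psumr_eq0P _ b00 iV) ?scale0r// => j _; exact: c0.
right; exists (a, b^-1 *: \sum_(i | ~~ `[< p i = v >]) c i *: p i) => /=; last first.
  have -> : 1 - a = b by lra.
  by rewrite scalerA mulfV// scale1r.
split; first by rewrite in_itv/=; apply/andP; split => //; lra.
have [i0 i0V] : exists i, ~~ V i.
  apply/existsP; apply: contra_neqT bn0 => /existsPn iV.
  by rewrite /b big1// => i iV'; have := iV i; rewrite iV'.
have Xp i : ~~ V i -> X (p i).
  by move=> /asboolPn pv; have [/pv|] := vXp i.
(* Indices sent to [v] receive weight 0 and the dummy point [p i0], since [combinations] requires
   every point to be in [X]. *)
rewrite convex_hullE; exists I, (fun i => if V i then 0 else b^-1 * c i),
  (fun i => if V i then p i0 else p i); split.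
- by move=> i; case: ifP => // _; rewrite mulr_ge0 ?invr_ge0.
- rewrite -[RHS](mulVf bn0) {2}/b mulr_sumr [RHS]big_mkcond.
  by apply: eq_bigr => i _; rewrite /V /=; case: asboolP.
- by move=> i; case: (boolP (V i)) => [_|/Xp//]; exact: Xp.
- rewrite scaler_sumr big_mkcond; apply: eq_bigr => i _.
  by rewrite /V /=; case: asboolP => _ /=; rewrite ?scale0r ?scalerA.
Qed.

End ConvexHull.

(** * Compactness and half-space sections of polytopes *)

Section Polytopes.
Local Open Scope ring_scope.
Variables (R : realType) (n : nat).
Implicit Types (X Y C P Q : set 'rV[R]_n) (x y : 'rV[R]_n) (u : 'cV[R]_n).

Lemma set_cons_seq (T : eqType) (v : T) s : [set` v :: s] = v |` [set` s].
Proof.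
apply/seteqP; split=> x /=; rewrite in_cons; first by case/orP=> [/eqP|]; [left|right].
by case=> [->|->]; rewrite ?eqxx ?orbT.
Qed.

Lemma compact_convex_hull X : finite_set X -> compact (convex_hull X).
Proof.
move=> /finite_seqP[s ->]; elim: s => [|v s IH].
  by rewrite (_ : [set` [::]] = set0) ?convex_hull0; [exact: compact0|apply/seteqP; split].
rewrite set_cons_seq convex_hullU1; apply: compactU; first exact: compact_set1.
apply: continuous_compact; last first.
  by apply: compact_setX IH; exact: segment_compact.
apply: continuous_subspaceT => -[t y].
apply: cvgD; apply: cvgZ => /=.
- exact: cvg_fst.
- exact: cvg_cst.
- by apply: cvgB; [exact: cvg_cst|exact: cvg_fst].
- exact: cvg_snd.
Qed.

Lemma closed_convex_hull X : finite_set X -> closed (convex_hull X).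
Proof.
by move=> /compact_convex_hull; apply: compact_closed; exact: norm_hausdorff.
Qed.

Definition form u x : R := (x *m u) 0 0.

Lemma form_sum u (I : finType) (c : I -> R) (p : I -> 'rV[R]_n) :
  form u (\sum_i c i *: p i) = \sum_i c i * form u (p i).
Proof.
rewrite /form mulmx_suml summxE; apply: eq_bigr => i _.
by rewrite -scalemxAl mxE.
Qed.

(** Points of weight 0 may lie anywhere: they are replaced by a point of positive weight. *)
Lemma combinations_support X (I : finType) (c : I -> R) (p : I -> 'rV[R]_n) :
  (forall i, 0 <= c i) -> \sum_i c i = 1 -> (forall i, c i != 0 -> X (p i)) ->
  convex_hull X (\sum_i c i *: p i).
Proof.
move=> c0 c1 Xp; have [i0 ci0] : exists i, c i != 0.
  apply/existsP; apply: contraTT (oner_neq0 R) => /existsPn ci; rewrite negbK -c1 big1// => i _.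
  by have := ci i; rewrite negbK => /eqP.
rewrite convex_hullE; exists I, c, (fun i => if c i == 0 then p i0 else p i); split=> //.
  by move=> i; case: eqVneq => [_|/Xp//]; exact: Xp.
by apply: eq_bigr => i _; case: eqVneq => [->|//]; rewrite !scale0r.
Qed.

(* Splits the part of a convex combination where an affine form [f] is negative
   among the points [f i *: q j - f j *: q i], proportional to the points where the
   segments from the positive side [A] to the negative side meet [f = 0]. *)
Lemma exchange_weights (V : lmodType R) (I : finType) (A : pred I) (c f : I -> R) (q : I -> V) :
  let a := \sum_(i | A i) c i * f i in let b := \sum_(i | ~~ A i) c i * f i in
  a != 0 ->
  \sum_(i | A i) \sum_(j | ~~ A j) (c i * c j / a) *: (f i *: q j - f j *: q i) =
  \sum_(j | ~~ A j) c j *: q j - (b / a) *: \sum_(i | A i) c i *: q i.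
Proof.
move=> a b a0.
transitivity (\sum_(i | A i) ((c i * f i / a) *: (\sum_(j | ~~ A j) c j *: q j) -
     (b / a) *: (c i *: q i))).
  apply: eq_bigr => i _; rewrite scaler_sumr scalerA /b mulr_suml mulr_suml scaler_suml.
  rewrite -sumrB; apply: eq_bigr => j _; rewrite scalerBr !scalerA.
  by congr (_ *: _ - _ *: _); ring.
by rewrite sumrB -scaler_suml -scaler_sumr -mulr_suml -/a divff// scale1r.
Qed.

(** The section is spanned by the points of [X] in the half-space and by the points where segments
    from these to the other points of [X] cross the boundary. *)
Lemma convex_hull_halfspace X u (k : R) : finite_set X ->
  exists2 Y, finite_set Y &
    convex_hull X `&` [set x | k <= form u x] = convex_hull Y.
Proof.
move=> fX; pose f x := form u x - k.
have fE (I : finType) (c : I -> R) (p : I -> 'rV[R]_n) : \sum_i c i = 1 ->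
    f (\sum_i c i *: p i) = \sum_i c i * f (p i).
  move=> c1; rewrite /f form_sum -[k in LHS]mul1r -c1 mulr_suml -sumrB.
  by apply: eq_bigr => i _; rewrite mulrBr.
(* The zero of the affine function [f] on the line through [a] and [b]. *)
pose cross a b := (f a - f b)^-1 *: (f a *: b - f b *: a).
pose Xp := X `&` [set x | 0 <= f x]; pose Xn := X `&` [set x | f x < 0].
exists (Xp `|` [set cross a b | a in Xp & b in Xn]).
  rewrite finite_setU; split; first exact: finite_setIl.
  by apply: finite_image2; exact: finite_setIl.
apply/seteqP; split=> [x [+ kx]|]; last first.
  have -> : convex_hull X `&` [set x | k <= form u x] =
            convex_hull X `&` [set x | 0 <= f x].
    by apply/seteqP; split=> x [Xx] /= kx; split=> //; move: kx; rewrite /= subr_ge0.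
  have fconv x y t : f (t *: x + (1 - t) *: y) = t * f x + (1 - t) * f y.
    by rewrite /f /form mulmxDl -!scalemxAl !mxE; ring.
  have cH : @convex_set R 'rV[R]_n [set x | 0 <= f x].
    apply/convex_setE => x y t /andP[t0 t1] /= fx fy.
    by rewrite fconv addr_ge0// mulr_ge0// subr_ge0.
  have cXH : @convex_set R 'rV[R]_n (convex_hull X `&` [set x | 0 <= f x]).
    apply/convex_setE => x y t t01 [hx fx] [hy fy]; split.
      by have /convex_setE := @convex_convex_hull _ _ X; exact.
    by have /convex_setE := cH; exact.
  apply: convex_hull_min => // z [[Xz fz]|[a [Xa fa] [b [Xb /= fb] <-]]].
    by split=> //; exact: sub_hull.
  have ab : 0 < f a - f b by rewrite subr_gt0 (lt_le_trans fb).
  have cE : cross a b = (- f b / (f a - f b)) *: a + (1 - - f b / (f a - f b)) *: b.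
    rewrite /cross scalerBr !scalerA addrC -scaleNr; congr (_ *: _ + _ *: _);
      by field; rewrite ?gt_eqF.
  split; last first.
    by rewrite /= cE fconv [X in 0 <= X](_ : _ = 0)//; field; rewrite gt_eqF.
  have /convex_setE := @convex_convex_hull _ _ X; rewrite cE; apply; try exact: sub_hull.
  rewrite ler_pdivrMr// mul1r divr_ge0 ?(ltW ab)//=; last by rewrite oppr_ge0 ltW.
  by rewrite lerDr.
rewrite convex_hullE => -[I [c [p [c0 c1 Xpi xE]]]].
have fx : 0 <= f x by rewrite subr_ge0.
pose A := [pred i | 0 <= f (p i)].
have fA i : ~~ A i -> f (p i) < 0 by rewrite /= -ltNge.
move: fx; rewrite xE fE// (bigID A)/=.
set a := \sum_(i | _) _; set b := \sum_(i | ~~ _) _ => ab.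
have a0 : 0 <= a by apply: sumr_ge0 => i Ai; exact: mulr_ge0.
have b0 : b <= 0.
  by apply: sumr_le0 => i /fA Ai; rewrite mulr_ge0_le0// ltW.
(* If [a] vanishes then so does [b], being nonpositive with [0 <= a + b]; hence the points on the
   negative side carry no weight. *)
have [a00|an0] := eqVneq a 0.
  have b00 : \sum_(i | ~~ A i) - (c i * f (p i)) = 0 by rewrite sumrN -/b; lra.
  apply: combinations_support => // i ci; left; split=> //.
  rewrite /= leNgt; apply/negP => fi; move: ci.
  have Ai : ~~ A i by rewrite /= -ltNge.
  have := psumr_eq0P _ b00 Ai; rewrite -mulrN => /(_ _)/eqP.
  rewrite mulf_eq0 oppr_eq0 (lt_eqF fi) orbF => -> // j /fA fj.
  by rewrite -mulrN mulr_ge0// oppr_ge0 ltW.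
have {}a0 : 0 < a by rewrite lt_neqAle eq_sym an0.
(* Each negative point gives all its weight to crossing points, shared among the positive points [i]
   in proportion to [c i * f (p i)]. Each positive point keeps the fraction [1 + b / a] of its
   weight. *)
pose w (k : I + I * I) : R := match k with
  | inl i => if A i then c i * (1 + b / a) else 0
  | inr (i, j) => if A i && ~~ A j then c i * c j / a * (f (p i) - f (p j)) else 0 end.
pose q (k : I + I * I) := match k with
  | inl i => p i | inr (i, j) => cross (p i) (p j) end.
have ba : 0 <= 1 + b / a.
  by rewrite -(divff an0) -mulrDl divr_ge0// ltW.
(* Stated for any [V] because it serves twice: with row vectors it recovers the point [x], and with
   the constant 1 in [R^o] it shows that the new weights sum to 1. *)
have W (V : lmodType R) (g : I + I * I -> V) (h : I -> V) :
    (forall i, g (inl i) = h i) ->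
    (forall i j, A i -> ~~ A j ->
       (f (p i) - f (p j)) *: g (inr (i, j)) = f (p i) *: h j - f (p j) *: h i) ->
    \sum_k w k *: g k = \sum_i c i *: h i.
  move=> g1 g2; rewrite big_sumType /= [RHS](bigID A)/=.
  have -> : \sum_i (if A i then c i * (1 + b / a) else 0) *: g (inl i) =
      (1 + b / a) *: \sum_(i | A i) c i *: h i.
    rewrite scaler_sumr [RHS]big_mkcond; apply: eq_bigr => i _ /=.
    by case: ifP => _; rewrite ?scale0r// g1 scalerA mulrC.
  rewrite (eq_bigr (fun k => if A k.1 && ~~ A k.2 then
      (c k.1 * c k.2 / a) *: (f (p k.1) *: h k.2 - f (p k.2) *: h k.1) else 0)); last first.
    by move=> [i j] _ /=; case: ifP => [/andP[Ai Aj]|_]; rewrite ?scale0r// -g2// scalerA.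
  rewrite -big_mkcond -(pair_big A (fun j => ~~ A j) (fun i j =>
      (c i * c j / a) *: (f (p i) *: h j - f (p j) *: h i)))/=.
  rewrite exchange_weights// -/a -/b scalerDl scale1r.
  by rewrite -addrA; congr (_ + _); rewrite addrCA subrr addr0.
have := W 'rV[R]_n q p (fun=> erefl) _; rewrite -xE => <-; last first.
  move=> i j Ai /fA Aj; rewrite /= /cross scalerA mulfV ?scale1r//.
  by rewrite gt_eqF// subr_gt0 (lt_le_trans Aj).
apply: combinations_support.
- move=> [i|[i j]] /=; case: ifP => //; first by rewrite mulr_ge0.
  move=> /andP[Ai /fA Aj]; apply: mulr_ge0; first by rewrite divr_ge0 ?mulr_ge0// ltW.
  by rewrite subr_ge0 ltW// (lt_le_trans Aj).
- have := W R^o (fun=> 1) (fun=> 1) (fun=> erefl) _.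
  rewrite (eq_bigr w) => [->|k' _]; last by rewrite /GRing.scale /= mulr1.
    by rewrite -[RHS]c1; apply: eq_bigr => i _; rewrite /GRing.scale /= mulr1.
  by move=> i j _ _; rewrite /GRing.scale /= !mulr1.
- move=> [i|[i j]] /=; case: ifP; rewrite ?eqxx//; first by left; split.
  move=> /andP[Ai /fA Aj] _.
  by right; exists (p i); [split|exists (p j); [split|]].
Qed.

End Polytopes.

(** * Polyhedra, open subpolyhedra and affine dimension *)

Section Polyhedra.
Local Open Scope ring_scope.
Variables (R : realType) (n : nat).
Implicit Types (X Y C P Q W : set 'rV[R]_n) (x y : 'rV[R]_n) (u : 'cV[R]_n).

Lemma polyhedron0 : @polyhedron R n set0.
Proof.
exists 0%N, (fun=> set0); split=> [i|]; first exact: finite_set0.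
by apply/seteqP; split=> // x [[]].
Qed.

Lemma polyhedron_hull X : finite_set X -> polyhedron (convex_hull X).
Proof.
move=> fX; exists 1%N, (fun=> X); split=> //.
by apply/seteqP; split=> x; [exists ord0|case].
Qed.

Lemma polyhedronU P Q : polyhedron P -> polyhedron Q -> polyhedron (P `|` Q).
Proof.
move=> [k [V [fV ->]]] [l [W [fW ->]]].
exists (k + l)%N, (fun i : 'I_(k + l) =>
  match fintype.split i with inl i => V i | inr j => W j end).
split=> [i|]; first by case: (fintype.split i).
apply/seteqP; split=> [x [[i _ xi]|[i _ xi]]|x [i _]].
- by exists (lshift l i) => //; rewrite -[lshift l i]/(unsplit (inl i)) unsplitK.
- by exists (rshift k i) => //; rewrite -[rshift k i]/(unsplit (inr i)) unsplitK.
- by case: (fintype.split i) => j xj; [left|right]; exists j.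
Qed.

Lemma polyhedron_bigcup (I : finType) (D : set I) (F : I -> set 'rV[R]_n) :
  (forall i, D i -> polyhedron (F i)) -> polyhedron (\bigcup_(i in D) F i).
Proof.
move=> DF; suff H (s : seq I) : polyhedron (\bigcup_(i in [set i | D i /\ i \in s]) F i).
  rewrite (_ : D = [set i | D i /\ i \in enum I]); first exact: H.
  by apply/seteqP; split=> [i Di|i []//]; rewrite /= mem_enum.
elim: s => [|i s IH].
  by rewrite (_ : bigcup _ _ = set0); [exact: polyhedron0|apply/seteqP; split=> // x [i []]].
have [Di|nDi] := pselect (D i); last first.
  rewrite (_ : [set j | _] = [set j | D j /\ j \in s])//; apply/seteqP.
  split=> j [Dj] js; split=> //; last by rewrite in_cons js orbT.
  by move: js; rewrite in_cons => /orP[/eqP ji|//]; case: nDi; rewrite -ji.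
have := polyhedronU (DF _ Di) IH; congr polyhedron; apply/seteqP; split=> x.
  move=> [xi|[j [Dj js] xj]]; first by exists i => //; split=> //; exact: mem_head.
  by exists j => //; split=> //; rewrite in_cons js orbT.
move=> [j [Dj]]; rewrite in_cons => /orP[/eqP ->|js] xj; first by left.
by right; exists j.
Qed.

Lemma polyhedron_finite X : finite_set X -> polyhedron X.
Proof.
move=> /finite_seqP[s ->]; elim: s => [|v s IH].
  by rewrite (_ : [set` [::]] = set0); [exact: polyhedron0|apply/seteqP; split].
rewrite set_cons_seq; apply: polyhedronU IH.
rewrite (_ : [set v] = convex_hull [set v]); first exact/polyhedron_hull/finite_set1.
apply/seteqP; split; first exact: sub_hull.
apply: convex_hull_min => //; apply/convex_setE => x y t _ -> ->.
by rewrite -scalerDl addrC subrK scale1r.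
Qed.

Lemma polyhedron_halfspace P u (k : R) : polyhedron P ->
  polyhedron (P `&` [set x | k <= form u x]).
Proof.
move=> [m [V [fV ->]]].
have /choice[Y Yp] : forall i, exists Y, finite_set Y /\
    convex_hull (V i) `&` [set x | k <= form u x] = convex_hull Y.
  by move=> i; have [Y] := convex_hull_halfspace u k (fV i); exists Y.
exists m, Y; split=> [i|]; first by have [] := Yp i.
by rewrite setI_bigcupl; apply: eq_bigcupr => i _; have [] := Yp i.
Qed.

Lemma formN u x : form (- u) x = - form u x.
Proof. by rewrite /form mulmxN mxE. Qed.

Lemma polyhedron_halfspace_le P u (k : R) : polyhedron P ->
  polyhedron (P `&` [set x | form u x <= k]).
Proof.
move=> /(polyhedron_halfspace (- u) (- k)); congr polyhedron.
by apply/seteqP; split=> x [Px] /=; rewrite formN lerN2.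
Qed.

Lemma closed_polyhedron P : polyhedron P -> closed P.
Proof.
move=> [k [V [fV ->]]]; apply: closed_bigcup; first exact: finite_finset.
by move=> i _; exact: closed_convex_hull.
Qed.

Lemma open_subpolyhedraP P W : open_subpolyhedra P W <->
  W `<=` P /\ polyhedron (P `\` W).
Proof.
split=> [[Q [pQ QP] <-]|[WP pW]].
  by split; [exact: subDsetl|rewrite setDD setIidr].
by exists (P `\` W); [split=> //; exact: subDsetl|rewrite setDD setIidr].
Qed.

Lemma open_subpolyhedraI P W W' :
  open_subpolyhedra P W -> open_subpolyhedra P W' -> open_subpolyhedra P (W `&` W').
Proof.
move=> /open_subpolyhedraP[WP pW] /open_subpolyhedraP[W'P pW'].
apply/open_subpolyhedraP; split; first by move=> x [/WP].
by rewrite setDIr; exact: polyhedronU.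
Qed.

Lemma open_subpolyhedra_lt P u (k : R) : polyhedron P ->
  open_subpolyhedra P (P `&` [set x | form u x < k]).
Proof.
move=> pP; apply/open_subpolyhedraP; split; first exact: subIsetl.
have := polyhedron_halfspace u k pP; congr polyhedron.
apply/seteqP; split=> x [Px] /=; first by move=> kx; split=> // -[_]; rewrite ltNge kx.
by move=> /not_andP[//|/negP]; rewrite -leNgt.
Qed.

Lemma open_subpolyhedra_gt P u (k : R) : polyhedron P ->
  open_subpolyhedra P (P `&` [set x | k < form u x]).
Proof.
move=> /(open_subpolyhedra_lt (- u) (- k)); congr open_subpolyhedra.
by apply/seteqP; split=> x [Px] /=; rewrite formN ltrN2.
Qed.

(* [C] contains [d + 1] affinely independent points. *)
Definition affdim_ge C d := exists (x0 : 'rV[R]_n) (M : 'M[R]_(d, n)),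
  [/\ row_free M, C x0 & forall i, C (x0 + row i M)].

Lemma affdim_ge_le C d : affdim_ge C d -> (d <= n)%N.
Proof. by move=> [_ [M [/eqP Md _ _]]]; rewrite -[leqLHS]Md; exact: rank_leq_col. Qed.

Lemma affdim_geS C d x0 (M : 'M[R]_(d, n)) y : row_free M -> C x0 ->
  (forall i, C (x0 + row i M)) -> C y -> ~ (exists c, y = x0 + c *m M) ->
  affdim_ge C d.+1.
Proof.
move=> Mf Cx0 CM Cy yM; exists x0, (col_mx (y - x0) M : 'M[R]_(1 + d, n)); split=> //.
  apply: (@inj_row_free _ (1 + d) n) => v; rewrite -[v]hsubmxK mul_row_col.
  (* In a linear relation, a nonzero coefficient [a] of [y - x0] would put [y] in the affine
     span. *)
  set a := lsubmx v; set b := rsubmx v => ab.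
  have a0 : a = 0.
    apply/eqP; apply: contra_notT yM => an0.
    exists (- (a 0 0)^-1 *: b); apply/eqP; rewrite addrC -subr_eq; apply/eqP.
    have a00 : a 0 0 != 0.
      by apply: contra_neq an0 => a00; apply/matrixP => i j; rewrite !ord1 a00 mxE.
    move: ab; rewrite {1}[a]mx11_scalar mul_scalar_mx => /eqP.
    rewrite addr_eq0 => /eqP/(congr1 ( *:%R (a 0 0)^-1)).
    by rewrite scalerA mulVf// scale1r scalerN scaleNr mulNmx scalemxAl.
  move: ab; rewrite a0 mul0mx add0r => /eqP; rewrite mulmx_free_eq0// => /eqP ->.
  exact: row_mx0.
move=> i; rewrite -[i](@splitK 1 d); case: (fintype.split (i : 'I_(1 + d))) => j /=.
  have -> : row (lshift d j) (col_mx (y - x0) M) = y - x0 by rewrite rowKu row_id.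
  by rewrite addrC subrK.
have -> : row (rshift 1 j) (col_mx (y - x0) M) = row j M by rewrite rowKd.
exact: CM.
Qed.

Lemma mulmx_row_continuous d (M : 'M[R]_(d, n)) :
  continuous (fun c : 'rV[R]_d => c *m M).
Proof.
rewrite (_ : mulmx^~ M = fun c : 'rV[R]_d => \sum_i c 0 i *: row i M); last first.
  by apply/funext => c; rewrite mulmx_sum_row.
apply: continuous_big => [|i _].
  exact: add_continuous.
by move=> c; apply: (@cvgZr_tmp _ _ _ (nbhs c)); exact: coord_continuous.
Qed.

Lemma affine_continuous d (x0 : 'rV[R]_n) (M : 'M[R]_(d, n)) :
  continuous (fun c : 'rV[R]_d => x0 + c *m M).
Proof.
move=> c; apply: (@cvgD _ _ _ (nbhs c)); first exact: cvg_cst.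
exact: mulmx_row_continuous.
Qed.

Lemma near_ray d (O : set 'rV[R]_d) c w : open O -> O c ->
  \forall e \near 0^'+, O (c + e *: w).
Proof.
move=> oO Oc; have : c + e *: w @[e --> 0^'+] --> c + (0 : R) *: w.
  apply: cvg_at_right_filter; apply: cvgD; first exact: cvg_cst.
  by apply: cvgZr_tmp; exact: cvg_id.
by rewrite scale0r addr0; apply; exact: open_nbhs_nbhs.
Qed.

(** An open set of parameters contains a small simplex with vertex [c0] and edges [e] times the unit
    vectors, with one [e] for all directions. *)
Lemma open_rows C d x0 (M : 'M[R]_(d, n)) (O : set 'rV[R]_d) c0 :
  row_free M -> open O -> O c0 -> (forall c, O c -> C (x0 + c *m M)) ->
  exists2 e, e != 0 & [/\ row_free (e *: M), C (x0 + c0 *m M) &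
    forall i, C (x0 + c0 *m M + row i (e *: M))].
Proof.
move=> Mf oO Oc0 OC.
have : \forall e \near 0^'+, forall i : 'I_d, O (c0 + e *: delta_mx 0 i).
  by apply: filter_forall => i; exact: near_ray.
move=> eO; have [e [e0 Oe]] : exists e : R, 0 < e /\ forall i : 'I_d, O (c0 + e *: delta_mx 0 i).
  by near (0 : R)^'+ => e; exists e; split; near: e => //; exact: nbhs_right_gt.
exists e; first by rewrite lt0r_neq0.
split; [|exact: OC|move=> i].
- by move: Mf; rewrite /row_free mxrank_scale_nz// lt0r_neq0.
- by rewrite linearZ /= rowE scalemxAl -addrA -mulmxDl; exact: OC.
Unshelve. all: by end_near.
Qed.

Lemma affdim_ge_open C d x0 (M : 'M[R]_(d, n)) (O : set 'rV[R]_d) c0 :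
  row_free M -> open O -> O c0 -> (forall c, O c -> C (x0 + c *m M)) ->
  affdim_ge C d.
Proof.
move=> Mf oO Oc0 OC; have [e _ [? ? ?]] := open_rows Mf oO Oc0 OC.
by exists (x0 + c0 *m M), (e *: M).
Qed.

Lemma affdim_ge_openS C d x0 (M : 'M[R]_(d, n)) (O : set 'rV[R]_d) c0 y :
  row_free M -> open O -> O c0 -> (forall c, O c -> C (x0 + c *m M)) ->
  C y -> ~ (exists c, y = x0 + c *m M) -> affdim_ge C d.+1.
Proof.
move=> Mf oO Oc0 OC Cy yM; have [e _ [eMf Ce CeM]] := open_rows Mf oO Oc0 OC.
apply: (affdim_geS eMf Ce CeM Cy).
move=> [c yE]; apply: yM; exists (c0 + e *: c).
by rewrite yE -addrA mulmxDl -scalemxAl scalemxAr.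
Qed.

(** Parameters of the interior of a simplex: barycentric coordinates without that of the base
    vertex, which is 1 minus the sum. *)
Definition open_simplex d : set 'rV[R]_d :=
  [set c | (forall i, 0 < c 0 i) /\ \sum_i c 0 i < 1].

Lemma open_open_simplex d : open (@open_simplex d).
Proof.
rewrite openE => c [c0 c1].
have pos : nbhs c [set c' : 'rV[R]_d | forall i, 0 < c' 0 i].
  apply: (@filter_forall _ _ (fun i => [set c' : 'rV[R]_d | 0 < c' 0 i]) (nbhs c)) => i.
  apply: (@coord_continuous R 1 d 0 i c [set y | 0 < y]).
  exact: open_nbhs_nbhs (conj (@open_gt R 0) (c0 i)).
have sum1 : nbhs c [set c' : 'rV[R]_d | \sum_i c' 0 i < 1].
  have cs : continuous (fun c' : 'rV[R]_d => \sum_i c' 0 i).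
    by apply: continuous_big => [|i _]; [exact: add_continuous|exact: coord_continuous].
  apply: (cs c [set y | y < 1]).
  exact: open_nbhs_nbhs (conj (@open_lt R 1) c1).
exact: (filterI pos sum1).
Qed.

Lemma open_simplex_neq0 d : @open_simplex d !=set0.
Proof.
exists (const_mx d.+1%:R^-1); split=> [i|]; first by rewrite mxE invr_gt0.
under eq_bigr do rewrite mxE.
by rewrite sumr_const card_ord -[_ *+ _]mulr_natl ltr_pdivrMr// mul1r ltr_nat.
Qed.

Lemma open_simplex_hull C d x0 (M : 'M[R]_(d, n)) c : @convex_set R 'rV[R]_n C ->
  C x0 -> (forall i, C (x0 + row i M)) -> open_simplex c -> C (x0 + c *m M).
Proof.
move=> cC Cx0 CM [c0 c1].
pose w (o : 'I_1 + 'I_d) := if o is inr i then c 0 i else 1 - \sum_i c 0 i.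
pose p (o : 'I_1 + 'I_d) := if o is inr i then x0 + row i M else x0.
have -> : x0 + c *m M = \sum_o w o *: p o.
  rewrite big_sumType big_ord1 /= mulmx_sum_row scalerBl scale1r -addrA; congr (_ + _).
  rewrite scaler_suml -sumrN -big_split; apply: eq_bigr => i _.
  by rewrite /= scalerDr addrA addNr add0r.
apply: convex_set_sum => //.
- by case=> i /=; [rewrite subr_ge0 ltW|exact: ltW].
- by rewrite big_sumType big_ord1 /= subrK.
- by case.
Qed.

End Polyhedra.

(** A finite form of Baire's theorem: either [O] lies in the first closed set, or removing that set
    leaves a nonempty open set covered by the others. *)
Lemma open_closed_cover (T : topologicalType) (I : eqType) (s : seq I)
    (F : I -> set T) (O : set T) :
  open O -> O !=set0 -> (forall i, i \in s -> closed (F i)) ->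
  (forall x, O x -> exists2 i, i \in s & F i x) ->
  exists i, i \in s /\ exists V, [/\ open V, V !=set0 & V `<=` O `&` F i].
Proof.
elim: s O => [|i s IH] O oO O0 cF cov; first by have [x /cov[]] := O0.
have [[x [Ox Fx]]|OF] := pselect (exists x, O x /\ ~ F i x); last first.
  exists i; split; [exact: mem_head|exists O; split=> // x Ox].
  by split=> //; apply: contrapT => Fx; apply: OF; exists x.
have oOF : open (O `\` F i).
  by apply: openI => //; rewrite openC; apply: cF; exact: mem_head.
have OF0 : O `\` F i !=set0 by exists x.
have [j|y [/cov[j] + Fj] nFi|j [js [V [oV V0 VF]]]] := IH _ oOF OF0.
- by move=> js; apply: cF; rewrite in_cons js orbT.
- by rewrite in_cons => /orP[/eqP ji|js]; [case: nFi; rewrite -ji|exists j].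
- exists j; split; first by rewrite in_cons js orbT.
  by exists V; split=> // z /VF[[]].
Qed.

(** * Fans as open images of polyhedra *)

(** Under the alternative, [l] and [e * t] never have opposite signs. This is what makes the
    projection to the fan open. *)
Lemma sign_addM (R : realType) (l e t : R) : (0 < e)%R ->
  sign l = None \/ sign l = sign t -> sign (l + e * t)%R = sign t.
Proof.
move=> e0; rewrite /sign.
have [l0|l0|->] := ltgtP l 0%R; have [t0|t0|->] := ltgtP t 0%R; case=> // _;
  rewrite ?mulr0 ?addr0 ?add0r ?eqxx//.
- have lt : (l + e * t < 0)%R by nra.
  by rewrite lt_eqF// (lt_gtF lt).
- have lt : (0 < l + e * t)%R by nra.
  by rewrite gt_eqF// lt.
- have lt : (e * t < 0)%R by nra.
  by rewrite lt_eqF// (lt_gtF lt).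
- have lt : (0 < e * t)%R by nra.
  by rewrite gt_eqF// lt.
Qed.

Lemma sign_ge0 (R : realType) (l : R) :
  (0 <= l)%R <-> sign l = None \/ sign l = Some true.
Proof. by rewrite /sign; case: ltgtP; split=> //; try (by case); [right|left]. Qed.

Lemma sign_le0 (R : realType) (l : R) :
  (l <= 0)%R <-> sign l = None \/ sign l = Some false.
Proof. by rewrite /sign; case: ltgtP; split=> //; try (by case); [right|left]. Qed.

(** * Transfer of validity along continuous open maps to a Kripke frame *)

Section Transfer.
Variables (T : Type) (O : set (set T)) (top U : set T).
Variables (d : Order.disp_t) (K : porderType d) (f : T -> K).
(** Continuity of [f] on [U] for the topology of up-sets; [f_open] is its openness: points of [U]
    over any [y] above [f x] are found in every [W] around [x]. *)
Hypothesis O_preimage : forall S, up_closed S -> O (U `&` f @^-1` S).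
Hypothesis f_open : forall x y W, U x -> (f x <= y)%O -> O W -> W x ->
  exists x', [/\ U x', W x' & f x' = y].

Lemma heval_forces (v : nat -> set K) A x : (forall i, up_closed (v i)) -> U x ->
  heval O (fun i => U `&` f @^-1` v i) A x <-> forces v (f x) A.
Proof.
move=> vup; elim: A x => [i||A IA B IB|A IA B IB|A IA B IB] x Ux /=.
- by split=> [[]|].
- by [].
- by have := IA x Ux; have := IB x Ux; rewrite /setI /=; tauto.
- by have := IA x Ux; have := IB x Ux; rewrite /setU /=; tauto.
- split=> [[W [OW WAB] Wx] y xy yA|AB].
    have [x' [Ux' Wx' yE]] := f_open Ux xy OW Wx.
    rewrite -yE in yA *; apply/IB => //; apply: WAB; split=> //; exact/IA.
  (* The member of the union [himp] to use is the preimage of the principal up-set of [f x]. *)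
  exists (U `&` f @^-1` [set y | (f x <= y)%O]); last by split=> //=.
  split; first by apply: O_preimage => y z yz /= xy; exact: le_trans xy yz.
  move=> z [[Uz /= xz]] /IA => /(_ Uz) zA; apply/IB => //; exact: AB.
Qed.

Lemma heyting_valid_frame_valid A : U `<=` top ->
  (exists2 x, U x & forall y, (f x <= y)%O) ->
  heyting_valid O top A -> frame_valid K A.
Proof.
move=> Utop [x0 Ux0 x0y] vA v vup y.
have OU : O U.
  by have := @O_preimage setT (fun _ _ _ _ => I); rewrite preimage_setT setIT.
have [x [Ux _ <-]] := f_open Ux0 (x0y y) OU Ux0.
by apply/heval_forces => //; rewrite vA; [exact: Utop|move=> i; exact: O_preimage].
Qed.

End Transfer.

Section FanTransfer.
Local Open Scope ring_scope.
Variables (R : realType) (n : nat).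
Implicit Types (P Q W : set 'rV[R]_n).

Lemma polyhedron_forall (I : finType) (G : I -> set 'rV[R]_n) P :
  (forall i Q, polyhedron Q -> polyhedron (Q `&` G i)) ->
  polyhedron P -> polyhedron (P `&` [set x | forall i, G i x]).
Proof.
move=> GQ pP; suff H (s : seq I) : polyhedron (P `&` [set x | forall i, i \in s -> G i x]).
  have := H (enum I); congr polyhedron; apply/seteqP.
  split=> x [Px Gx]; first by split=> // i; apply: Gx; rewrite mem_enum.
  by split=> // i _; exact: Gx.
elim: s => [|i s IH].
  by rewrite (_ : P `&` _ = P)//; apply/seteqP; split=> // x [].
have := GQ i _ IH; congr polyhedron; apply/seteqP; split=> x.
  move=> [[Px Gx] Gix]; split=> // j.
  by rewrite in_cons => /orP[/eqP->//|]; exact: Gx.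
move=> [Px Gx]; split; last by apply: Gx; exact: mem_head.
by split=> // j js; apply: Gx; rewrite in_cons js orbT.
Qed.

(** The sign condition is weakened to include 0, so it cuts out a closed half-space or a
    hyperplane. *)
Lemma polyhedron_sign_le P u (k : R) (s : option bool) : polyhedron P ->
  polyhedron (P `&` [set x | sign (form u x - k) = None \/ sign (form u x - k) = s]).
Proof.
move=> pP; have ge := polyhedron_halfspace u k pP.
have le := polyhedron_halfspace_le u k pP.
have eq := polyhedron_halfspace_le u k ge.
case: s => [[]|].
- congr polyhedron : ge; apply/seteqP; split=> x [Px] /=; rewrite -subr_ge0.
    by move=> /sign_ge0.
  by move=> /sign_ge0.
- congr polyhedron : le; apply/seteqP; split=> x [Px] /=; rewrite -subr_le0.
    by move=> /sign_le0.
  by move=> /sign_le0.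
- congr polyhedron : eq; apply/seteqP; split=> x.
    move=> [[Px /= k1] k2]; split=> //=; left; rewrite /sign ifT//.
    by rewrite subr_eq0 eq_le k2.
  move=> [Px /= H]; have {}H : form u x = k.
    by case: H => /eqP; rewrite sign_eq_None subr_eq0 => /eqP.
  by split=> /=; rewrite ?H.
Qed.

Lemma formD u (x y : 'rV[R]_n) : form u (x + y) = form u x + form u y.
Proof. by rewrite /form mulmxDl mxE. Qed.

Lemma polyhedron_valid_fan (k : nat) (V : 'I_k -> set 'rV[R]_n) A m :
  (forall i, finite_set (V i)) -> (exists i, affdim_ge (convex_hull (V i)) 2) ->
  polyhedron_valid (\bigcup_i convex_hull (V i)) A -> frame_valid (fan R m) A.
Proof.
move=> fV dim2; set P := \bigcup_i _.
have pP : polyhedron P by exists k, V.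
pose hasdim d := `[< exists i, affdim_ge (convex_hull (V i)) d >].
have ex2 : hasdim 2%N by exact/asboolP.
have ubn d : hasdim d -> (d <= n)%N by move=> /asboolP[i]; exact: affdim_ge_le.
have exd : exists d, hasdim d by exists 2%N.
(* The dimension [d] is the largest among the pieces of [P]; being at least 2, it leaves two
   coordinates for the fan. *)
have [d /asboolP[i0 [x0 [M [Mf Vx0 VM]]]] dmax] := ex_maxnP exd ubn.
have d1 : (1 < d)%N by exact: dmax.
have closedV i : closed (convex_hull (V i)) by exact: closed_convex_hull.
pose bad i := exists2 y, convex_hull (V i) y & ~ exists c, y = x0 + c *m M.
pose pt (c : 'rV[R]_d) := x0 + c *m M.
have pt_cont : continuous pt by exact: affine_continuous.
have ptV c : open_simplex c -> convex_hull (V i0) (pt c).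
  by apply: open_simplex_hull => //; exact: convex_convex_hull.
(* A piece that is bad, i.e. not contained in the affine span of the chosen simplex
   of maximal dimension, has no interior relative to that span: otherwise it
   would have a larger dimension. So the bad pieces do not cover the simplex. *)
have [c0 [c0S c0bad]] : exists c0, open_simplex c0 /\
    forall i, bad i -> ~ convex_hull (V i) (pt c0).
  apply: contrapT => nc0.
  have [i|c cS|i [ibad [Z [oZ [c Zc] ZV]]]] := @open_closed_cover _ _
      [seq i <- enum 'I_k | `[< bad i >]] (fun i => pt @^-1` convex_hull (V i))
      _ (@open_open_simplex R d) (@open_simplex_neq0 R d).
  - by move=> _; apply: closed_comp => // c _; exact: pt_cont.
  - apply: contrapT => nV; apply: nc0; exists c; split=> // i ib Vi.
    by apply: nV; exists i => //; rewrite mem_filter mem_enum andbT; exact/asboolP.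
  - move: ibad; rewrite mem_filter => /andP[/asboolP[y Vy yM] _].
    have : hasdim d.+1.
      apply/asboolP; exists i; apply: (affdim_ge_openS Mf oZ Zc _ Vy yM).
      by move=> c' /ZV[].
    by move=> /dmax; rewrite ltnn.
pose co (x : 'rV[R]_n) : 'rV[R]_d := (x - x0) *m pinvmx M.
have coK c : co (pt c) = c by rewrite /co /pt addrC addKr -mulmxA mulmxVp// mulmx1.
(* Off the bad pieces [P] lies in the affine span of the simplex, so a point of [U] is determined by
   its parameters [co x]. *)
pose U : set 'rV[R]_n := [set x | [/\ P x, forall i, bad i -> ~ convex_hull (V i) x &
  open_simplex (co x)]].
have ptU c : open_simplex c -> (forall i, bad i -> ~ convex_hull (V i) (pt c)) ->
    U (pt c).
  by move=> cS cb; split; rewrite ?coK//; exists i0 => //; exact: ptV.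
have Upt x : U x -> x = pt (co x).
  move=> [[i _ Vix] xb _]; have [c xE] : exists c, x = x0 + c *m M.
    by apply: contrapT => nx; apply: (xb i) => //; exists x.
  by rewrite xE -/(pt c) coK.
pose ucol j : 'cV[R]_n := col j (pinvmx M).
have coE x j : co x 0 j = form (ucol j) x - form (ucol j) x0.
  by rewrite /form !mxE -sumrB; apply: eq_bigr => l _; rewrite !mxE mulrBl.
pose usum := \sum_j ucol j.
have co_sum x : \sum_j co x 0 j = form usum x - form usum x0.
  under eq_bigr do rewrite coE.
  by rewrite sumrB /form !mulmx_sumr !summxE.
have OU : open_subpolyhedra P U.
  apply/open_subpolyhedraP; split=> [x []//|].
  have -> : P `\` U = \bigcup_(i in bad) convex_hull (V i) `|`
      (\bigcup_(j in setT) (P `&` [set x | form (ucol j) x <= form (ucol j) x0]) `|`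
       P `&` [set x | 1 + form usum x0 <= form usum x]).
    apply/seteqP; split=> [x [Px nUx]|x [[i ib Vix]|[[j _ [Px /= lej]]|[Px /= le1]]]].
    - apply: contrapT => /not_orP[nb /not_orP[nj ns]]; apply: nUx; split=> //.
        by move=> i ib Vix; apply: nb; exists i.
      split=> [j|].
        rewrite coE subr_gt0 ltNge; apply/negP => lej.
        by apply: nj; exists j.
      rewrite co_sum ltrBlDr ltNge; apply/negP => le1; exact: ns.
    - split; first by exists i.
      by move=> [_ /(_ i ib)].
    - by split=> // -[_ _ [/(_ j)]]; rewrite coE subr_gt0 ltNge lej.
    - by split=> // -[_ _ [_]]; rewrite co_sum ltrBlDr ltNge le1.
  apply: polyhedronU; first by apply: polyhedron_bigcup => i _; exact: polyhedron_hull.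
  apply: polyhedronU; last exact: polyhedron_halfspace.
  by apply: polyhedron_bigcup => j _; exact: polyhedron_halfspace_le.
pose j0 : 'I_d := Ordinal (ltnW d1); pose j1 : 'I_d := Ordinal d1.
(* Two coordinates centred at [c0] project to the plane of the fan. The form [w i] and constant
   [l i] below describe the pullback of the [i]-th line. *)
pose f x := fan_face m (co x 0 j0 - c0 0 j0) (co x 0 j1 - c0 0 j1).
pose w (i : 'I_m) := ucol j1 - i%:R *: ucol j0.
pose l (i : 'I_m) := form (w i) x0 + c0 0 j1 - i%:R * c0 0 j0.
have fE x i : val (f x) i = sign (form (w i) x - l i).
  rewrite ffunE !coE /l /w /form !mulmxBr -!scalemxAr !mxE; congr sign.
  by ring.
have O_preimage S : up_closed S -> open_subpolyhedra P (U `&` f @^-1` S).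
  move=> Sup; apply/open_subpolyhedraP; split=> [x [[]]//|].
  (* By [fE] the sign condition says [f x <= s]; as [S] is up-closed, it misses [f x] exactly when
     some such [s] is outside [S]. *)
  have -> : P `\` (U `&` f @^-1` S) = (P `\` U) `|` \bigcup_(s in ~` S)
      (P `&` [set x | forall i, sign (form (w i) x - l i) = None \/
                               sign (form (w i) x - l i) = val s i]).
    apply/seteqP; split=> [x [Px]|x [[Px nUx]|[s nSs [Px fs]]]].
    - move=> /not_andP[nUx|nfx]; [by left|right; exists (f x) => //].
      by split=> // i; right; rewrite fE.
    - by split=> // -[].
    - split=> // -[_ /= Sfx]; apply: nSs; apply: Sup Sfx.
      by apply/fan_leP => i; rewrite fE.
  apply: polyhedronU; first by have /open_subpolyhedraP[] := OU.
  apply: polyhedron_bigcup => s _; apply: polyhedron_forall => // i Q pQ.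
  exact: polyhedron_sign_le.
apply: (@heyting_valid_frame_valid _ (open_subpolyhedra P) P U _ _ f) => //.
- move=> x y W Ux xy OW Wx; have [al [be yE]] := fan_faceP y.
  have [WP pW] := (open_subpolyhedraP P W).1 OW.
  (* This lifts the point [(al, be)] of the face [y]; by [sign_addM] any positive step from [co x]
     along [v] reaches [y]. The closed set [B] holds the parameters of bad pieces and of [P] outside
     [W], which a short step avoids. *)
  pose v : 'rV[R]_d := al *: delta_mx 0 j0 + be *: delta_mx 0 j1.
  pose B := pt @^-1` (\bigcup_(i in bad) convex_hull (V i) `|` (P `\` W)).
  have oB : open (~` B).
    rewrite openC; apply: closed_comp => [c _|]; first exact: pt_cont.
    apply: closedU; last exact: closed_polyhedron.
    by apply: closed_polyhedron; apply: polyhedron_bigcup => i _; exact: polyhedron_hull.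
  have [_ xb xS] := Ux.
  have oSB : open (@open_simplex R d `&` ~` B) by apply: openI => //; exact: open_open_simplex.
  have SBx : (@open_simplex R d `&` ~` B) (co x).
    split=> //; rewrite /B /= -Upt// => -[[i ib]|[_ //]]; exact: xb.
  have [e [e0 [eS eB]]] : exists e : R, 0 < e /\ (@open_simplex R d `&` ~` B) (co x + e *: v).
    near (0 : R)^'+ => e; exists e; split; near: e; first exact: nbhs_right_gt.
    exact: near_ray.
  have Uxe : U (pt (co x + e *: v)).
    by apply: ptU => // i ib Vi; apply: eB; left; exists i.
  exists (pt (co x + e *: v)); split=> //.
    by apply: contrapT => nW; apply: eB; right; split=> //; have [] := Uxe.
  apply: val_inj; apply/ffunP => i; rewrite yE !ffunE coK.
  have -> : (co x + e *: v) 0 j1 = co x 0 j1 + e * be.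
    by rewrite !mxE !eqxx /= mulr0 add0r mulr1.
  have -> : (co x + e *: v) 0 j0 = co x 0 j0 + e * al.
    by rewrite !mxE !eqxx /= mulr0 addr0 mulr1.
  move: xy => /fan_leP /(_ i); rewrite yE !ffunE => /(sign_addM e0) <-.
  by congr sign; ring.
- by move=> x [].
(* The centre [c0] projects to the common point of the lines, the root of the fan. *)
- exists (pt c0); first exact: ptU.
  move=> y; apply/fan_leP => i; left.
  by rewrite ffunE coK !subrr mulr0 subrr /sign eqxx.
Unshelve. all: by end_near.
Qed.

End FanTransfer.

(** * Polyhedra of dimension at most 1 *)

Definition bd2 : formula :=
  Or (Var 1) (Imp (Var 1) (Or (Var 0) (Imp (Var 0) Bot))).

Section DepthTwo.
Local Open Scope ring_scope.
Variables (R : realType) (n : nat).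
Implicit Types (x y z : 'rV[R]_n).

(** Pulled back to the parameters of a simplex in [C], the hulls are finitely many closed sets
    covering an open set, so one of them contains an open piece. *)
Lemma affdim_ge_cover (k : nat) (V : 'I_k -> set 'rV[R]_n) C d :
  (forall i, finite_set (V i)) -> @convex_set R 'rV[R]_n C ->
  C `<=` \bigcup_i convex_hull (V i) -> affdim_ge C d ->
  exists i, affdim_ge (convex_hull (V i)) d.
Proof.
move=> fV cC CV [x0 [M [Mf Cx0 CM]]].
pose pt (c : 'rV[R]_d) := x0 + c *m M.
have pt_cont : continuous pt by exact: affine_continuous.
have [i|c cS|i [_ [Z [oZ [c Zc] ZV]]]] := @open_closed_cover _ _
    (enum 'I_k) (fun i => pt @^-1` convex_hull (V i))
    _ (@open_open_simplex R d) (@open_simplex_neq0 R d).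
- by move=> _; apply: closed_comp => [c _|]; [exact: pt_cont|exact: closed_convex_hull].
- have [i _ Vi] := CV _ (open_simplex_hull cC Cx0 CM cS).
  by exists i => //; rewrite mem_enum.
- by exists i; apply: (@affdim_ge_open _ _ _ _ x0 M Z c) => // c' /ZV[].
Qed.

Lemma affdim_ge2 C x y z : x != y -> C x -> C y -> C z ->
  ~ (exists t : R, z = x + t *: (y - x)) -> affdim_ge C 2.
Proof.
move=> xy Cx Cy Cz nz.
apply: (@affdim_geS _ _ _ 1 x (y - x) z) => //.
- by rewrite /row_free rank_rV eqb1 subr_eq0 eq_sym.
- by move=> i; rewrite row_id addrC subrK.
- move=> [c zE]; apply: nz; exists (c 0 0).
  by rewrite -mul_scalar_mx -mx11_scalar.
Qed.

Lemma form_self_gt0 x : x != 0 -> 0 < form x^T x.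
Proof.
move=> x0; rewrite /form mxE lt_neqAle sumr_ge0 ?andbT; last first.
  by move=> i _; rewrite mxE -expr2 sqr_ge0.
apply: contra_neq x0 => /esym s0; apply/rowP => i; rewrite mxE.
have := psumr_eq0P _ s0 (i := i) isT; rewrite mxE => h.
apply/eqP; rewrite -[_ == _]orbb -mulf_eq0 h// => j _.
by rewrite mxE -expr2 sqr_ge0.
Qed.

(** Otherwise all points of [X] have parameter [t < 1] on the line, and so has their hull, whereas
    [y] has parameter 1. *)
Lemma beyond_vertex X x y : convex_hull X y -> y != x -> ~ X y ->
  (forall u, X u -> exists t : R, u = x + t *: (y - x)) ->
  exists2 t : R, 1 < t & X (x + t *: (y - x)).
Proof.
move=> hy yx nXy line; apply: contrapT => nt.
have yx0 : y - x != 0 by rewrite subr_eq0.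
have : convex_hull X `<=` [set z | exists2 t : R, t < 1 & z = x + t *: (y - x)].
  apply: convex_hull_min => [|u Xu].
    apply/convex_setE => _ _ s /andP[s0 s1] [t t1 ->] [t' t'1 ->].
    exists (s * t + (1 - s) * t').
      have [->|sn0] := eqVneq s 0; first by lra.
      have : 0 < s * (1 - t) by rewrite mulr_gt0 ?subr_gt0// lt_neqAle eq_sym sn0.
      have : 0 <= (1 - s) * (1 - t') by rewrite mulr_ge0 ?subr_ge0// ltW.
      by lra.
    move: (y - x) => D; rewrite !scalerDr !scalerA addrACA -!scalerDl.
    by rewrite [s + (1 - s)]addrC subrK scale1r.
  have [t uE] := line u Xu; exists t => //; rewrite ltNge le_eqVlt.
  apply/negP => /orP[/eqP t1|t1]; last by apply: nt; exists t; rewrite -?uE.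
  by apply: nXy; move: Xu; rewrite uE -t1 scale1r addrC subrK.
move=> /(_ y hy) [t t1 yE].
have : (1 - t) *: (y - x) = 0.
  by rewrite scalerBl scale1r {1}yE [x + _]addrC addrK subrr.
by move=> /eqP; rewrite scaler_eq0 (negPf yx0) orbF subr_eq0 (gt_eqF t1).
Qed.

(** The claim is local: a point [x] outside [v 1] has a neighbourhood in which every point [y] of
    [v 1] lies in [v 0] or has a neighbourhood disjoint from [v 0]. Since [y] differs from [x], near
    [y] the polyhedron is just a segment pointing away from [x]. *)
Lemma polyhedron_valid_bd2 (k : nat) (V : 'I_k -> set 'rV[R]_n) :
  (forall i, finite_set (V i)) -> ~ (exists i, affdim_ge (convex_hull (V i)) 2) ->
  polyhedron_valid (\bigcup_i convex_hull (V i)) bd2.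
Proof.
move=> fV ndim2; set P := \bigcup_i _ => v Ov.
have pP : polyhedron P by exists k, V.
have OP W : open_subpolyhedra P W -> W `<=` P by move=> /open_subpolyhedraP[].
have [/OP O1P [l [Wq [fW Q1E]]]] := conj (Ov 0%N) (proj2 ((open_subpolyhedraP P _).1 (Ov 0%N))).
have Q1P j : convex_hull (Wq j) `<=` P `\` v 0%N.
  by move=> z jz; rewrite Q1E; exists j.
apply/seteqP; split=> [x [|[W [/OP WP _] /WP//]]|x Px] /=.
  exact: (OP _ (Ov 1%N)).
have [|nO2x] := pselect (v 1%N x); [by left|right].
pose badV z := [set i | ~ convex_hull (V i) z].
have pbadV z : polyhedron (\bigcup_(i in badV z) convex_hull (V i)).
  by apply: polyhedron_bigcup => i _; exact: polyhedron_hull.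
pose badW := [set j | ~ convex_hull (Wq j) x].
(* Points close to [x] only lie in pieces that contain [x], and are not vertices
   of pieces of [P `\` v 0] unless they are [x]. *)
pose B := \bigcup_(i in badV x) convex_hull (V i) `|`
  (\bigcup_(j in badW) convex_hull (Wq j) `|` (\bigcup_j Wq j) `\` [set x]).
have vertP : (\bigcup_j Wq j) `<=` P.
  by move=> z [j _ /sub_hull jz]; have [] := Q1P _ _ jz.
exists (P `\` B); last first.
  split=> // -[[i bi Vx]|[[j bj Wx]|[_ /=]]]; [exact: bi|exact: bj|exact].
split.
  exists B => //; split.
    apply: polyhedronU => //; apply: polyhedronU.
      by apply: polyhedron_bigcup => j _; exact: polyhedron_hull.
    apply: polyhedron_finite; apply: finite_setD.
    by apply: bigcup_finite => //; exact: finite_finset.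
  move=> z [[i _ Vz]|[[j _ /Q1P[]//]|[/vertP//]]]; by exists i.
move=> y [[Py nBy] O2y] /=.
have [|nO1y] := pselect (v 0%N y); [by left|right].
have yx : y != x by apply: contra_notN nO2x => /eqP <-.
have [j _ Wy] : (\bigcup_j convex_hull (Wq j)) y by rewrite -Q1E.
have Wx : convex_hull (Wq j) x.
  by apply: contrapT => nW; apply: nBy; right; left; exists j.
(* Otherwise a triangle lies in [P], hence by the covering lemma one of the pieces
   of [P] has dimension 2. *)
have line u : Wq j u -> exists t : R, u = x + t *: (y - x).
  move=> Wu; apply: contrapT => nu; apply: ndim2.
  apply: (@affdim_ge_cover _ _ (convex_hull (Wq j))) => //.
  - exact: convex_convex_hull.
  - by move=> z /Q1P[].
  - by apply: affdim_ge2 Wx Wy (sub_hull Wu) nu; rewrite eq_sym.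
have nWy : ~ Wq j y.
  by move=> Wjy; apply: nBy; right; right; split; [exists j|exact/eqP].
have [t t1 Wu] := beyond_vertex Wy yx nWy line.
set u := x + _ in Wu.
(* The form [g] is the inner product with [y - x]. It increases from [x] through [y] to [u], so two
   strict inequalities on it isolate the part strictly between [x] and [u]. *)
pose g := (y - x)^T.
have g0 : 0 < form g (y - x) by apply: form_self_gt0; rewrite subr_eq0.
have gE (s : R) : form g (x + s *: (y - x)) = form g x + s * form g (y - x).
  by rewrite formD /form -scalemxAl [X in _ + X = _]mxE.
have yE : y = x + 1 *: (y - x) by rewrite scale1r addrC subrK.
(* Near [y], [P] is contained in the segment from [x] to the vertex [u] beyond [y],
   which avoids [v 0]. *)
exists ((P `\` \bigcup_(i in badV y) convex_hull (V i)) `&`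
   ((P `&` [set z | form g x < form g z]) `&` (P `&` [set z | form g z < form g u]))).
  split.
    apply: open_subpolyhedraI.
      exists (\bigcup_(i in badV y) convex_hull (V i)); last by [].
      by split=> // z [i _ Vz]; exists i.
    by apply: open_subpolyhedraI; [exact: open_subpolyhedra_gt|exact: open_subpolyhedra_lt].
  move=> z [[[Pz nbz] [[_ /= xz] [_ /= zu]]] O1z].
  have [i _ Vz] := Pz.
  have Vy : convex_hull (V i) y.
    by apply: contrapT => nV; apply: nbz; exists i.
  have Vx : convex_hull (V i) x.
    by apply: contrapT => nV; apply: nBy; left; exists i.
  (* A point off the line would span with [x] and [y] a triangle inside the piece [V i]. *)
  have [[s zE]|nz] := pselect (exists s : R, z = x + s *: (y - x)); last first.
    by apply: ndim2; exists i; apply: affdim_ge2 Vx Vy Vz nz; rewrite eq_sym.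
  have s0 : 0 < s by move: xz; rewrite zE gE; nra.
  have st : s < t by move: zu; rewrite zE /u !gE; nra.
  have : convex_hull (Wq j) z.
    have -> : z = (s / t) *: u + (1 - s / t) *: x.
      rewrite zE /u; move: (y - x) => D; rewrite scalerDr scalerA divfK; last first.
        by rewrite gt_eqF//; lra.
      by rewrite addrAC -scalerDl [s / t + _]addrC subrK scale1r.
    have /convex_setE := @convex_convex_hull R n (Wq j); apply=> //; last exact: sub_hull.
    by rewrite divr_ge0 ?ler_pdivrMr; lra.
  by move=> /Q1P[].
have Pn : ~ (\bigcup_(i in badV y) convex_hull (V i)) y by move=> [i bi]; exact: bi.
split=> //; split; split=> //=.
  by rewrite [in X in _ < X]yE gE mul1r ltrDl.
by rewrite [in X in X < _]yE /u !gE ltrD2l ltr_pM2r.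
Qed.

End DepthTwo.

(** * Height and stability *)

Lemma height_ge2_chain (R : realType) (d : Order.disp_t) (F : porderType d) :
  (2%:E <= height F R)%E -> exists x y z : F, (x < y)%O /\ (y < z)%O.
Proof.
(* A supremum need not be attained, but it exceeds 1 only if some chain, possibly infinite, has more
   than two elements. *)
move=> h2; have : (1%:E < height F R)%E by apply: lt_le_trans h2; rewrite lte_fin ltr1n.
move=> /ereal_sup_gt[_ [X /= Xtot <-] X2].
have [B BX B3] : exists2 B : {fset F}, [set` B] `<=` X & (3 <= #|` B|%fset)%N.
  have [fX|] := pselect (finite_set X); last exact: infinite_set_fset.
  exists (fset_set X); first by rewrite fset_setK.
  move: X2; rewrite /counting asboolT// -EFinB lte_fin ltrBrDr.
  by rewrite -[X in (X < _)%R]/(2%:R)%R ltr_nat.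
have {}BX x : x \in enum_fset B -> X x by exact: BX.
case: (enum_fset B) (fset_uniq B) B3 BX => [|a [|b [|c s]]] //=.
rewrite !in_cons !negb_or => /and4P[/and3P[ab ac _] /andP[bc _] _ _] _ sX.
have Xa : X a by apply: sX; rewrite !in_cons eqxx.
have Xb : X b by apply: sX; rewrite !in_cons eqxx orbT.
have Xc : X c by apply: sX; rewrite !in_cons eqxx !orbT.
have cmp x y : X x -> X y -> x != y -> (x < y)%O \/ (y < x)%O.
  by move=> Xx Xy xy; rewrite !lt_neqAle xy eq_sym xy; exact: Xtot.
have [ab'|ba] := cmp _ _ Xa Xb ab; have [bc'|cb] := cmp _ _ Xb Xc bc;
  have [ac'|ca] := cmp _ _ Xa Xc ac.
- by exists a, b, c.
- by exists a, b, c.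
- by exists a, c, b.
- by exists c, a, b.
- by exists b, a, c.
- by exists b, c, a.
- by exists c, b, a.
- by exists c, b, a.
Qed.

(** Let [Var 1] hold off the down-set of [x] and [Var 0] off that of [y]. Then [Var 1] fails at [x]
    and holds at [y], where [Var 0] fails without being refuted, as it holds at [z]. *)
Lemma chain_refutes_bd2 (d : Order.disp_t) (F : porderType d) (x y z : F) :
  (x < y)%O -> (y < z)%O -> ~ frame_valid F bd2.
Proof.
move=> xy yz bd.
pose v (i : nat) : set F := if i is 0%N then [set w | ~ (w <= y)%O] else [set w | ~ (w <= x)%O].
have vup i : up_closed (v i).
  by case: i => [|i] u w uw /= nu wle; apply: nu; exact: le_trans uw wle.
have /= [|/(_ y (ltW xy))] := bd v vup x; first by apply.
case=> [yx||/(_ z (ltW yz)) H].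
- by have := lt_le_trans xy yx; rewrite ltxx.
- by apply.
- by apply: H => zy; have := lt_le_trans yz zy; rewrite ltxx.
Qed.

Theorem theorem5p4 (R : realType) (L : set formula)
  (L_logic : intermediate_logic L)
  (L_stable : stable L)
  (L_neq_IPC : L <> IPC)
  (L_height : exists (d : Order.disp_t) (F : porderType d),
      (2%:E <= height F R)%E /\ frame_validates F L) :
  ~ polyhedrally_complete R L.
Proof.
move=> [C [Cpoly LC]]; apply: L_neq_IPC; apply/seteqP.
split; last exact: logic_IPC L_logic.
have nLbd2 : ~ L bd2.
  have [d [F [/height_ge2_chain[x [y [z [xy yz]]]] FL]]] := L_height.
  by move=> /FL; exact: chain_refutes_bd2 xy yz.
have [n [P [CP nPbd2]]] : exists n P, C n P /\ ~ polyhedron_valid P bd2.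
  apply: contrapT => nP; apply: nLbd2; rewrite LC => n P CP.
  by apply: contrapT => nV; apply: nP; exists n, P.
have [k [V [fV PE]]] := Cpoly _ _ CP.
have dim2 : exists i, affdim_ge (convex_hull (V i)) 2.
  by apply: contrapT => nd; apply: nPbd2; rewrite PE; exact: polyhedron_valid_bd2.
have fanL m : frame_validates (fan R m) L.
  move=> A; rewrite LC => /(_ _ _ CP); rewrite PE.
  exact: polyhedron_valid_fan.
move=> A LA; apply: IPC_finite_rooted => d G rG.
have [g [gle gsurj]] := fan_surjection R rG.
exact: (L_stable _ _ _ _ g (fan_rooted R _) (fanL _) gle gsurj).
Qed.
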